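(* The block $\rightarrow$ cluster problem can be solved in polynomial time: given a block graph $G$, a minimum set $V_-\subseteq V(G)$ such that $G - V_-$ is a cluster graph can be computed in polynomial time.
   Context: All graphs are finite, simple and undirected. A cluster graph is a graph every connected component of which is a clique. A block graph is a graph in which deleting all cut vertices leaves a cluster graph; equivalently, a chordal graph in which every block (maximal biconnected subgraph) is a clique, i.e., any two maximal cliques share at most one vertex. *)

(* Defs.v *)
From mathcomp Require Import all_boot.

Set Implicit Arguments.
Unset Strict Implicit.
Unset Printing Implicit Defensive.

(* A graph on the vertex type T is given by its adjacency relation. *)

Section Graphs.
Variables (T : finType) (e : rel T).

Definition induced (A : {set T}) : rel {x : T | x \in A} :=
  fun x y => e (val x) (val y).

(* G - S *)
Definition gdel (S : {set T}) : rel {x : T | x \in ~: S} := @induced (~: S).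

Definition clique (A : {set T}) : Prop :=
  forall x y, x \in A -> y \in A -> x != y -> e x y.

Definition component (x : T) : {set T} := [set y | connect e x y].

Definition cluster_graph : Prop := forall x, clique (component x).

Definition connected_graph : Prop := forall x y, connect e x y.

(* Deleting v disconnects two vertices that are connected in G. *)
Definition cut_vertex (v : T) : Prop :=
  exists x y : {z : T | z \in ~: [set v]},
    connect e (val x) (val y) /\ ~ connect (@gdel [set v]) x y.

(* In a simple graph, single vertices and single edges are biconnected in
   this sense, so that isolated vertices and bridges are blocks too. *)
Definition biconnected : Prop :=
  connected_graph /\ forall v, ~ cut_vertex v.

(* For x in c, next c x is the cyclic successor of x, so the chord {x, y}
   joins two vertices that are not consecutive on c. *)
Definition chordal : Prop :=
  forall c : seq T, ucycle e c -> 4 <= size c ->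
    exists x y, [/\ x \in c, y \in c, e x y, y != next c x & x != next c y].

End Graphs.

(* Maximal biconnected subgraphs are induced, hence given by vertex sets. *)
Definition block (T : finType) (e : rel T) (B : {set T}) : Prop :=
  biconnected (@induced T e B) /\
  forall B' : {set T}, B \subset B' -> biconnected (@induced T e B') -> B' = B.

Definition block_graph (T : finType) (e : rel T) : Prop :=
  chordal e /\ forall B : {set T}, block e B -> clique e B.

Definition cluster_deletion_set (T : finType) (e : rel T) (S : {set T}) : Prop :=
  cluster_graph (@gdel T e S).

Definition min_cluster_deletion_set (T : finType) (e : rel T) (S : {set T}) :
    Prop :=
  cluster_deletion_set e S /\
  forall S' : {set T}, cluster_deletion_set e S' -> #|S| <= #|S'|.

Record sgraph := SGraph {
  gorder : nat;
  gedge : rel 'I_gorder;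
  gedge_sym : symmetric gedge;
  gedge_irr : irreflexive gedge
}.

(* Random access machines with unit-cost instructions. The only arithmetic
   is addition and truncated subtraction, so t steps on an input of m bits
   produce numbers of O(t + log m) bits plus a constant depending on the
   program: polynomial time on this machine is polynomial time on a Turing
   machine. *)

Inductive instr :=
  | IConst of nat & nat         (* IConst r k   : R[r] := k *)
  | IAdd of nat & nat & nat     (* IAdd r s t   : R[r] := R[s] + R[t] *)
  | ISub of nat & nat & nat     (* ISub r s t   : R[r] := R[s] - R[t], truncated *)
  | IRead of nat & nat          (* IRead r s    : R[r] := M[R[s]] *)
  | IWrite of nat & nat         (* IWrite r s   : M[R[r]] := R[s] *)
  | IJump of nat                (* IJump l      : goto l *)
  | IJzero of nat & nat.        (* IJzero r l   : if R[r] = 0 goto l *)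

Definition program := seq instr.

Record config := Config {
  pc : nat;
  regs : nat -> nat;
  cells : nat -> nat
}.

Definition upd (f : nat -> nat) (a v : nat) : nat -> nat :=
  fun b => if b == a then v else f b.

Definition exec (i : instr) (s : config) : config :=
  let: Config p R M := s in
  match i with
  | IConst r k => Config p.+1 (upd R r k) M
  | IAdd r a b => Config p.+1 (upd R r (R a + R b)) M
  | ISub r a b => Config p.+1 (upd R r (R a - R b)) M
  | IRead r a => Config p.+1 (upd R r (M (R a))) M
  | IWrite r a => Config p.+1 R (upd M (R r) (R a))
  | IJump l => Config l R M
  | IJzero r l => Config (if R r == 0 then l else p.+1) R M
  end.

(* The machine halts when the program counter leaves the program. *)
Definition halted (P : program) (s : config) : bool := size P <= pc s.

Definition step (P : program) (s : config) : config :=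
  if onth P (pc s) is Some i then exec i s else s.

(* The word w is stored as its length in cell 0, followed by its bits. *)
Definition word_mem (w : seq bool) : nat -> nat :=
  fun a => if a is i.+1 then nth false w i : nat else size w.

Definition start (w : seq bool) : config :=
  Config 0 (fun=> 0) (word_mem w).

Definition outputs (s : config) (w : seq bool) : Prop :=
  forall a, a <= size w -> cells s a = word_mem w a.

Definition computes_in (P : program) (t : nat) (w out : seq bool) : Prop :=
  let s := iter t (step P) (start w) in halted P s /\ outputs s out.

(* Search problem with instances x : I satisfying dom x, presented as the
   word code x, and with sol x the accepted answers. *)
Definition poly_time_solvable (I : Type) (dom : I -> Prop)
    (code : I -> seq bool) (sol : I -> seq bool -> Prop) : Prop :=
  exists (P : program) (c k : nat), forall x : I, dom x ->
    exists (t : nat) (out : seq bool),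
      [/\ t <= c * size (code x) ^ k + c,
          computes_in P t (code x) out & sol x out].

(* Row-major adjacency matrix, gorder G * gorder G bits. *)
Definition graph_word (G : sgraph) : seq bool :=
  [seq @gedge G i j | i <- enum 'I_(gorder G), j <- enum 'I_(gorder G)].

Definition set_word (n : nat) (S : {set 'I_n}) : seq bool :=
  [seq i \in S | i <- enum 'I_n].

(* Main.v *)
Require Import Defs.
From mathcomp Require Import all_boot zify.

(** A greedy algorithm works.  Call a vertex [c] pendant at a neighbour [u] if
    all vertices of [N[c]] other than [u] have the closed neighbourhood [N[c]]:
    then [N[c]] is a clique attached to the rest of the graph at [u] only.  A
    vertex [v] is selected by
    - [rule_twin] if some [c] is pendant at [v] and [v] has a neighbour [w]
      outside [N[c]] whose neighbours lie in [N[v]], except possibly for those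
      in [N[d]] for some [d] pendant at [w];
    - [rule_exit] if [v] is the only neighbour outside [N[c]] of some [u] at
      which [c] is pendant.
    In any graph, an exchange argument turns a solution avoiding [v] into one of
    the same size containing [v].  Conversely, a block graph is chordal and
    diamond-free, and if it is not a cluster graph then a rule applies to the
    second or third vertex of a longest induced path, or to a common neighbour of
    these two: chordality says that an induced path is extended by any neighbour
    of its first vertex that is not adjacent to the second one.

    So deleting selected vertices as long as possible yields a minimum solution.
    The rules are first-order properties of the remaining graph, hence decidable
    by nested loops over the vertices. *)

Set Implicit Arguments.
Unset Strict Implicit.
Unset Printing Implicit Defensive.

(** * Deletion rules *)

Section Rules.
Variables (T : finType) (g : rel T).
Hypotheses (gsym : symmetric g) (girr : irreflexive g).

Definition adjeq (x y : T) : bool := g x y || (x == y).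

Definition P3_free (S : {set T}) : Prop :=
  forall a b c, a \notin S -> b \notin S -> c \notin S ->
    g a b -> g b c -> adjeq a c.

Definition pendant (c u : T) : bool :=
  g c u && [forall a, g a c ==> (a != u) ==> [forall b, adjeq a b == adjeq c b]].

Definition rule_twin (v : T) : bool :=
  [exists c, pendant c v && [exists w, [&& g w v, ~~ adjeq c w &
    [exists d, ((d == v) || pendant d w) &&
      [forall y, g w y ==> (adjeq d y || adjeq v y)]]]]].

Definition rule_exit (v : T) : bool :=
  [exists u, exists c, [&& pendant c u, g u v, ~~ adjeq c v &
    [forall y, g u y ==> (adjeq c y || (y == v))]]].

Definition rule (v : T) : bool := rule_twin v || rule_exit v.

Lemma adjeq_sym : symmetric adjeq.
Proof. by move=> x y; rewrite /adjeq gsym eq_sym. Qed.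

Lemma pendantP c u : reflect
  (g c u /\ forall a, adjeq c a -> a != u -> forall b, adjeq a b = adjeq c b)
  (pendant c u).
Proof.
apply: (iffP andP) => -[cu H]; split=> //.
  move=> a /orP[ca|/eqP<- //] au b; apply/eqP; move/forallP: H => /(_ a).
  by rewrite gsym ca au => /forallP/(_ b).
apply/forallP=> a; apply/implyP=> ac; apply/implyP=> au; apply/forallP=> b.
by apply/eqP/H => //; rewrite /adjeq gsym ac.
Qed.

Lemma adj_adjeq x y : g x y -> adjeq x y.
Proof. by rewrite /adjeq => ->. Qed.

Lemma pendant_clique c u a b : pendant c u ->
  adjeq c a -> adjeq c b -> adjeq a b.
Proof.
move=> /pendantP[cu H] ca cb; have [au|au] := eqVneq a u; last by rewrite H.
have [bu|bu] := eqVneq b u; first by rewrite au bu /adjeq eqxx orbT.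
by rewrite adjeq_sym H.
Qed.

(** The restored [x] is a twin of each of its surviving neighbours, whereas an induced path on three
    vertices through [x] contains a neighbour of [x] with a different closed neighbourhood. *)
Lemma P3_free_swap S x v : P3_free S ->
  (forall a b, a \notin v |: S :\ x -> b \notin v |: S :\ x ->
     g x a -> b != x -> adjeq a b = adjeq x b) ->
  P3_free (v |: S :\ x).
Proof.
move=> HS H a b c aS bS cS ab bc.
have inS z : z != x -> z \notin v |: S :\ x -> z \notin S.
  by move=> zx; rewrite !inE zx negb_or /= => /andP[].
have [ax|ax] := eqVneq a x.
  have [cx|cx] := eqVneq c x; first by rewrite ax cx /adjeq eqxx orbT.
  by rewrite ax -(H b c) // -?ax // adj_adjeq.
have [cx|cx] := eqVneq c x.
  by rewrite adjeq_sym cx -(H b a) // -?cx ?adj_adjeq // gsym.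
have [bx|bx] := eqVneq b x; last by apply: (HS a b c) => //; apply: inS.
by rewrite (H a c) // -?bx ?adj_adjeq // gsym.
Qed.

(** The neighbour [y] is recorded because, in the graph left by earlier deletions, it shows that [x]
    has not been deleted yet. *)
Lemma rule_sound v S : rule v -> P3_free S -> v \notin S ->
  exists x y, [/\ x \in S, g x y & P3_free (v |: S :\ x)].
Proof.
move=> /orP[] + HS vS.
- case/existsP=> c /andP[pc /existsP[w /and3P[wv cw /existsP[d /andP[hd Hw]]]]].
  have [cv Hc] := pendantP _ _ pc.
  (* A survivor [x] of [N[c]] other than [v] forces all neighbours of [v] outside [N[c]] into [S],
     in particular [w], which is exchanged for [v]. Without such an [x], the vertex [c] is
     exchanged: its only surviving neighbour was [v]. *)
  have [/existsP[x /and3P[cx xv xS]]|H0] :=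
    boolP [exists x, [&& adjeq c x, x != v & x \notin S]].
    have HS' y : g v y -> ~~ adjeq c y -> y \in S.
      move=> vy cy; apply: contraNT cy => yS; rewrite -(Hc x) //.
      apply: (HS x v y) => //; move: (Hc x cx xv v).
      by rewrite (adj_adjeq cv) /adjeq (negbTE xv) orbF.
    exists w, v; split=> //; first by apply: HS'; rewrite // gsym.
    apply: P3_free_swap => // a b aS bS wa bw.
    have aw : a != w by apply: contraTneq wa => ->; rewrite girr.
    move: aS; rewrite !inE aw /= negb_or => /andP[av aS].
    (* A survivor adjacent to [v] lies in [N[c]], hence has closed neighbourhood [N[c]], which
       misses [w]. *)
    have avN : ~~ g v a.
      apply/negP=> va; have ca : adjeq c a by apply: contraR aS; exact: HS'.
      by case/negP: cw; rewrite -(Hc a) // /adjeq gsym wa.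
    have da : adjeq d a.
      have /implyP/(_ wa)/orP[//|] := forallP Hw a.
      by rewrite /adjeq (negbTE avN) eq_sym (negbTE av).
    have pd : pendant d w.
      case/orP: hd da => // /eqP->.
      by rewrite /adjeq (negbTE avN) eq_sym (negbTE av).
    have [dw Hd] := pendantP _ _ pd; rewrite Hd //.
    apply/idP/idP=> [db|]; first by apply: pendant_clique pd (adj_adjeq dw) db.
    rewrite {1}/adjeq eq_sym (negbTE bw) orbF => wb.
    have bS' : b \notin S by move: bS; rewrite !inE bw negb_or => /andP[].
    have bv : b != v by move: bS; rewrite !inE bw negb_or => /andP[].
    have /implyP/(_ wb)/orP[//|] := forallP Hw b.
    rewrite /adjeq eq_sym (negbTE bv) orbF => vb.
    have cb : adjeq c b by apply: contraR bS'; exact: HS'.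
    by case/negP: cw; rewrite -(Hc b) // /adjeq gsym wb.
  have inS x : adjeq c x -> x != v -> x \in S.
    by move=> cx xv; apply: contraR H0 => xS; apply/existsP; exists x; rewrite cx xv.
  exists c, v; split=> //.
    by apply: inS; [rewrite /adjeq eqxx orbT | apply: contraTneq cv => ->; rewrite girr].
  apply: P3_free_swap => // a b aS _ ca _; case/negP: aS; rewrite !inE.
  case: eqVneq => //= av; rewrite inS ?adj_adjeq // andbT.
  by apply: contraTneq ca => ->; rewrite girr.
- case/existsP=> u /existsP[c /and4P[pc uv cv Hu]].
  have [cu Hc] := pendantP _ _ pc.
  (* Some vertex of [N[c]] is in [S], as otherwise [c], [u], [v] is an induced path. Deleting [v]
     makes [N[c]] a clique component, so any of its vertices may be restored. *)
  have [/existsP[x /andP[cx xS]]|H0] := boolP [exists x, adjeq c x && (x \in S)]; last first.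
    have nS x : adjeq c x -> x \notin S.
      by move=> cx; apply: contra H0 => xS; apply/existsP; exists x; rewrite cx.
    case/negP: cv; apply: (HS c u v) => //.
      by apply: nS; rewrite /adjeq eqxx orbT.
    exact/nS/adj_adjeq.
  have [y xy] : exists y, g x y.
    case/orP: cx => [|/eqP<-]; last by exists u.
    by exists c; rewrite gsym.
  exists x, y; split=> //.
  have stay a b : adjeq c a -> g a b -> b != v -> adjeq c b.
    move=> ca ab bv; have [au|au] := eqVneq a u.
      rewrite au in ab; have /implyP/(_ ab) := forallP Hu b.
      by rewrite (negbTE bv) orbF.
    by rewrite -(Hc a) // adj_adjeq.
  have nv z : z \notin v |: S :\ x -> z != v by rewrite !inE negb_or => /andP[].
  apply: P3_free_swap => // a b /nv av /nv bv xa bx.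
  have ca := stay _ _ cx xa av.
  have E z : adjeq c z -> adjeq z b = adjeq c b.
    move=> cz; apply/idP/idP=> [|cb]; last exact: pendant_clique pc cz cb.
    by case/orP=> [zb|/eqP<- //]; apply: stay cz zb bv.
  by rewrite !E.
Qed.

End Rules.

(** * Longest induced paths and the existence of a selected vertex *)

Section Existence.
Variables (T : finType) (g : rel T).
Hypotheses (gsym : symmetric g) (girr : irreflexive g).

Fixpoint induced_path (p : seq T) : bool :=
  if p is x :: p1 then
    (if p1 is y :: p2 then g x y && all (fun z => ~~ adjeq g x z) p2 else true)
    && induced_path p1
  else true.

Definition extendable : Prop := forall y x0 x1 p,
  induced_path [:: x0, x1 & p] -> g y x0 -> ~~ adjeq g y x1 ->
  induced_path [:: y, x0, x1 & p].

Definition diamond_free : Prop := forall x y a b,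
  g x y -> g x a -> g y a -> g x b -> g y b -> adjeq g a b.

Lemma induced_path_uniq p : induced_path p -> uniq p.
Proof.
elim: p => //= x [//|y p] IH /andP[/andP[xy xp] /IH ->]; rewrite andbT.
rewrite inE negb_or; apply/andP; split.
  by apply: contraTneq xy => ->; rewrite girr.
by apply/negP=> /(allP xp); rewrite /adjeq eqxx orbT.
Qed.

Hypotheses (ext : extendable) (df : diamond_free).

Section Longest.
Variable m : nat.
Hypothesis longest : forall p, induced_path p -> size p <= m.

(** If [y] missed [u], it would prolong the path in front of [c]; if it were adjacent to [x], the
    vertices [c], [x] and the edge from [y] to [u] would form a diamond. *)
Lemma longest_end c u x t y : induced_path [:: c, u, x & t] ->
    (size t).+3 = m -> g y c -> y != u -> 
  g y u /\ induced_path [:: y, u, x & t].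
Proof.
move=> P sz yc yu.
have yu' : g y u.
  apply: contraT => nyu; have /longest : induced_path [:: y, c, u, x & t].
    by apply: ext; rewrite // /adjeq negb_or nyu.
  by rewrite /= sz ltnn.
split=> //; apply: ext => //; first by case/andP: P.
move: P => /= /andP[/andP[cu /andP[cx _]] /andP[/andP[ux _] _]].
apply: contra cx => /orP[yx|/eqP<-]; last by rewrite adj_adjeq // gsym.
by apply: (df (x := y) (y := u)); rewrite // gsym.
Qed.

(** By [longest_end], every neighbour of [c] other than [u] also starts a longest path.
    Diamond-freeness at the edge to [u] carries neighbours over from one such vertex to an adjacent
    one. *)
Lemma longest_pendant c u x t : induced_path [:: c, u, x & t] ->
  (size t).+3 = m -> pendant g c u.
Proof.
move=> P sz; have cu : g c u by case/andP: P => /andP[].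
apply/(pendantP gsym); split=> // a ca au b.
have [->//|ac] := eqVneq a c.
have {}ca : g a c by case/orP: ca => [|/eqP E]; [rewrite gsym | rewrite E eqxx in ac].
have [aU Pa] := longest_end P sz ca au.
have half a1 a2 : induced_path [:: a1, u, x & t] -> g a2 a1 -> g a2 u ->
    a2 != u -> adjeq g a1 b -> adjeq g a2 b.
  move=> P1 a21 a2u n2; case/orP=> [a1b|/eqP<-]; last by rewrite adj_adjeq.
  have [->|bu] := eqVneq b u; first by rewrite adj_adjeq.
  have [bU _] := longest_end P1 sz (etrans (gsym _ _) a1b) bu.
  have a1u : g a1 u by case/andP: P1 => /andP[].
  by apply: (df (x := a1) (y := u)); rewrite // gsym.
apply/idP/idP; apply: half => //; first by rewrite gsym.
by apply: contraTneq cu => ->; rewrite girr.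
Qed.

(** A neighbour [w] of [u] outside [N[c]] and [N[x]] starts another longest path, so its neighbours
    lie in [N[u]], and [rule_twin] holds with [u] in the role of [d]. *)
Lemma longest_fork c u x t : induced_path [:: c, u, x & t] ->
  (size t).+3 = m -> rule_twin g u \/
  forall y, g u y -> adjeq g c y || adjeq g x y.
Proof.
move=> P sz; have pc := longest_pendant P sz.
have [/forallP H|] := boolP [forall y, g u y ==> (adjeq g c y || adjeq g x y)].
  by right=> y; apply/implyP.
rewrite negb_forall => /existsP[w]; rewrite negb_imply => /andP[uw].
rewrite negb_or => /andP[cw xw]; left.
have Pw : induced_path [:: w, u, x & t].
  by apply: ext; rewrite 1?adjeq_sym // 1?gsym //; case/andP: P.
apply/existsP; exists c; rewrite pc /=; apply/existsP; exists w.
rewrite gsym uw cw /=; apply/existsP; exists u; rewrite eqxx /=.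
apply/forallP=> y; apply/implyP=> wy; rewrite orbb.
have [<-|yu] := eqVneq y u; first by rewrite /adjeq eqxx orbT.
have [yu' _] := longest_end Pw sz (etrans (gsym _ _) wy) yu.
by rewrite adj_adjeq // gsym.
Qed.

Lemma longest_rule c u x t : induced_path [:: c, u, x & t] ->
  (size t).+3 = m -> exists v, rule g v.
Proof.
move=> P sz; have pc := longest_pendant P sz.
have [H|Hu] := longest_fork P sz; first by exists u; rewrite /rule H.
have /andP[/andP[cu /= /andP[cx _]] P1] := P.
have /andP[/andP[ux ut] P2] := P1.
(* If [u] and [x] have no common neighbour, then [x] is the only neighbour of [u] outside [N[c]],
   and [rule_exit] selects it. *)
have [/existsP[w /andP[uw xw]]|H0] := boolP [exists w, g u w && g x w]; last first.
  exists x; apply/orP; right; apply/existsP; exists u; apply/existsP; exists c.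
  rewrite pc ux cx /=; apply/forallP=> y; apply/implyP=> uy.
  case/orP: (Hu _ uy) => [->//|/orP[xy|/eqP<-]]; last by rewrite eqxx orbT.
  by case/negP: H0; apply/existsP; exists y; rewrite uy.
have cw : ~~ adjeq g c w.
  apply: contra cx => /orP[cw|/eqP E]; last by rewrite E adj_adjeq // gsym.
  by apply: (df (x := u) (y := w)); rewrite // gsym.
have Pw : induced_path [:: w, x & t].
  case: t {P P1 sz} ut P2 => [|x3 t] /= ut P2; first by rewrite gsym xw.
  have /andP[/andP[xx3 _] _] := P2.
  apply: ext; rewrite 1?gsym //; case/andP: ut => ux3 _.
  apply: contra ux3 => /orP[wx3|/eqP<-]; last exact: adj_adjeq.
  by apply: (df (x := x) (y := w)); rewrite // gsym.
(* It remains to find [d] for [rule_twin] at [u]: either [u] itself, or a neighbour [z] of [w]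
   outside [N[u]]. Such a [z] starts a longest path through [w] and is therefore pendant at [w]. *)
have concl d : (d == u) || pendant g d w ->
    (forall y, g w y -> adjeq g d y || adjeq g u y) -> exists v, rule g v.
  move=> hd Hd; exists u; apply/orP; left; apply/existsP; exists c.
  rewrite pc; apply/existsP; exists w; rewrite gsym uw cw; apply/existsP; exists d.
  by rewrite hd; apply/forallP=> y; apply/implyP; apply: Hd.
have [/forallP H|] := boolP [forall y, g w y ==> adjeq g u y].
  by apply: (concl u) => [|y wy]; rewrite ?eqxx // (implyP (H y)).
rewrite negb_forall => /existsP[z]; rewrite negb_imply => /andP[wz uz].
have near y : g w y -> adjeq g x y -> adjeq g u y.
  move=> wy /orP[xy|/eqP<-]; last exact: adj_adjeq.
  by apply: (df (x := x) (y := w)); rewrite // gsym.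
have Pz : induced_path [:: z, w, x & t].
  apply: ext; rewrite 1?gsym //; apply: contra uz; rewrite adjeq_sym //.
  exact: near.
have [H|Hw] := longest_fork Pz sz; first by exists w; rewrite /rule H.
apply: (concl z); first by rewrite (longest_pendant Pz sz) orbT.
by move=> y wy; case/orP: (Hw y wy) => [->//|/(near _ wy) ->]; rewrite orbT.
Qed.

End Longest.

(** A violating triple is an induced path, and induced paths have at most [#|T|] vertices; hence a
    longest one exists and has at least three. *)
Lemma no_rule_P3_free : ~ (exists v, rule g v) -> P3_free g set0.
Proof.
move=> nr a b c _ _ _ ab bc; apply: contraT => ac.
pose Q n := [exists t : n.-tuple T, induced_path t].
have Qabc : Q 3.
  by apply/existsP; exists [tuple a; b; c]; rewrite /= ab bc /= ac.
have Qbound n : Q n -> n <= #|T|.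
  case/existsP=> t /induced_path_uniq/card_uniqP E.
  by rewrite -(size_tuple t) -E max_card.
case: (ex_maxnP (ex_intro (fun n => is_true (Q n)) 3 Qabc) Qbound) => m /existsP[[p /= /eqP sp] ip] mx.
case: nr; have := mx _ Qabc; rewrite -sp.
case: p sp ip => [//|x [//|y [//|z t]]] sp ip _.
apply: (@longest_rule m _ _ _ _ _ ip) => // q iq; apply: mx.
by apply/existsP; exists (in_tuple q).
Qed.

End Existence.

(** * Block graphs and the greedy algorithm *)

Section BlockGraphs.
Variables (T : finType) (e : rel T).
Hypotheses (esym : symmetric e) (eirr : irreflexive e).

Lemma induced_path_catl p q : induced_path e (p ++ q) -> induced_path e p.
Proof.
elim: p => //= x p IH /andP[+ /IH ->]; case: p {IH} => //= y p.
by rewrite all_cat andbT => /and3P[-> ->].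
Qed.

Lemma induced_path_sorted p : induced_path e p -> sorted e p.
Proof. by elim: p => //= x [|y p] //= IH /andP[/andP[-> _] /IH]. Qed.

Lemma induced_path_nth x0 p i j : induced_path e p -> i < j < size p ->
  e (nth x0 p i) (nth x0 p j) -> j = i.+1.
Proof.
elim: p i j => [|x p IH] i j; first by rewrite /= ltn0 andbF.
case/andP=> h /IH {}IH; case: j => [|j]; first by rewrite ltn0.
case: i => [|i] /= hij; last by move/IH => ->.
case: p h IH hij => [|y p] //; case: j => // j /andP[_ /allP h] _ /= hj xj.
by have := h _ (mem_nth x0 hj); rewrite /adjeq xj.
Qed.

(** Otherwise let [z] be the first vertex of [p] equal or adjacent to [y]. Then [y] closes the path
    from [x0] to [z] to a chordless cycle of length at least four. *)
Lemma chordal_extendable : chordal e -> extendable e.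
Proof.
move=> ch y x0 x1 p ip yx0 yx1.
suff H : ~~ has (adjeq e y) p.
  by move: ip; rewrite /= yx0 yx1 => -> /=; rewrite all_predC H.
apply/negP=> hp; case: (split_find hp) ip => z p1 p2 yz nh ip.
have {p2}ip : induced_path e [:: x0, x1 & rcons p1 z].
  by apply: (@induced_path_catl _ p2).
set q := [:: x0, x1 & rcons p1 z] in ip.
have srt := induced_path_sorted ip.
have ny w : w \in x1 :: p1 -> ~~ adjeq e y w.
  rewrite inE => /orP[/eqP->//|wp]; apply: contra nh => yw.
  by apply/hasP; exists w.
have {}yz : e y z.
  case/orP: yz => // /eqP E; have : e (last x1 p1) z.
    by move: srt; rewrite /= rcons_path => /and3P[].
  rewrite -E esym => yl; have := ny (last x1 p1) (mem_last _ _).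
  by rewrite /adjeq yl.
have lq : last y q = z by rewrite /= last_rcons.
have yq : y \notin q.
  have nadj w : e y w -> y != w by apply: contraTneq => <-; rewrite eirr.
  rewrite !inE mem_rcons inE !negb_or (nadj _ yx0) (nadj _ yz) /=.
  have := ny x1; rewrite inE eqxx => /(_ isT); rewrite /adjeq negb_or => /andP[_ ->] /=.
  by apply/negP=> yp; have := ny y; rewrite inE yp orbT /adjeq eqxx orbT => /(_ isT).
have uq := induced_path_uniq eirr ip.
have uc : uniq (y :: q) by rewrite /= yq.
have cq : ucycle e (y :: q).
  apply/andP; split=> //; rewrite /cycle rcons_path lq (esym z) yz andbT.
  by apply/andP.
have sq : 4 <= size (y :: q) by rewrite /= size_rcons.
have [a [b [ac bc ab nab nba]]] := ch (y :: q) cq sq.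
(* The default [y] of [nth] covers the last vertex of [q], whose cyclic successor is the head
   [y]. *)
have nextq i : i < size q -> next (y :: q) (nth y q i) = nth y q i.+1.
  move=> iq; rewrite next_nth inE mem_nth // orbT.
  by rewrite -[nth y q i]/(nth y (y :: q) i.+1) index_uniq.
have atq w : e y w -> w \in q -> w = next (y :: q) y \/ y = next (y :: q) w.
  move=> yw; have [->|wx0] := eqVneq w x0; first by left; rewrite /= eqxx.
  rewrite 2!inE mem_rcons (negbTE wx0) /= inE orbCA -in_cons => /orP[/eqP->|/ny].
    right; have := nextq (size p1).+2; rewrite /= size_rcons nth_rcons ltnn eqxx.
    by move=> -> //; rewrite nth_default // size_rcons.
  by rewrite /adjeq yw.
move: ac bc; rewrite ![_ \in y :: q]in_cons => /orP[/eqP ay|aq] /orP[/eqP bY|bq].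
- by rewrite ay bY eirr in ab.
- by rewrite ay in ab nab nba; case: (atq _ ab bq) => E; move: nab nba; rewrite -E eqxx.
- rewrite bY esym in ab; rewrite bY in nab nba.
  by case: (atq _ ab aq) => E; move: nab nba; rewrite -E eqxx.
- have [i iq ai] := nthP y aq; have [j jq bj] := nthP y bq.
  rewrite -ai -bj in ab nab nba.
  have [ij|ij|ij] := ltngtP i j.
  + have E : j = i.+1 by apply: induced_path_nth ip _ ab; rewrite ij.
    by rewrite E nextq ?eqxx in nab.
  + have E : i = j.+1 by apply: (induced_path_nth (x0 := y)) ip _ _; rewrite ?ij // esym.
    by rewrite E nextq ?eqxx in nba.
  + by rewrite ij eirr in ab.
Qed.

Lemma hub_connect (U : finType) (r : rel U) (h : U) : symmetric r ->
  (forall z, z != h -> r z h) -> forall u w, connect r u w.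
Proof.
move=> rsym H u w; have Hc z : connect r z h.
  by have [->|/H/connect1] := eqVneq z h.
by apply: connect_trans (Hc u) _; rewrite (sym_connect_sym rsym).
Qed.

(** Deleting one vertex leaves at least one of the hubs [x] and [y], which is adjacent to everything
    else that remains. *)
Lemma biconnected_two_hubs x y (A : {set T}) : x \in A -> y \in A -> x != y ->
  (forall z, z \in A -> adjeq e x z && adjeq e y z) ->
  biconnected (@induced T e A).
Proof.
move=> xA yA xy HA.
have hub h z : h \in [:: x; y] -> z \in A -> z != h -> e z h.
  move=> hxy zA zh; have /andP[xz yz] := HA _ zA; rewrite esym.
  have : adjeq e h z by move: hxy; rewrite !inE => /orP[] /eqP->.
  by rewrite /adjeq eq_sym (negbTE zh) orbF.
split=> [|v [a [b [_ nab]]]].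
  apply: (@hub_connect _ _ (exist _ x xA)) => [a b|z zh]; first exact: esym.
  by apply: hub (valP z) zh; rewrite inE eqxx.
have [h hxy hv] : exists2 h : {z | z \in A}, val h \in [:: x; y] & h != v.
  have [E|] := eqVneq (exist _ x xA) v; last by exists (exist _ x xA); rewrite ?inE ?eqxx.
  exists (exist _ y yA); first by rewrite !inE eqxx orbT.
  by rewrite -E; apply: contra xy => /eqP[->].
have hv' : h \in ~: [set v] by rewrite !inE.
apply: nab; apply: (@hub_connect _ _ (exist _ h hv')) => [c d|z zh]; first exact: esym.
exact: hub hxy (valP (val z)) zh.
Qed.

(** The common closed neighbourhood of [x] and [y] has these two as hubs, so it is biconnected. A
    maximal biconnected superset is a block, hence a clique, and it contains [a] and [b]. *)
Lemma blocks_diamond_free :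
  (forall B : {set T}, block e B -> clique e B) -> diamond_free e.
Proof.
move=> HB x y a b xy xa ya xb yb; apply: contraT => nab.
suff H n (B : {set T}) : #|~: B| < n -> a \in B -> b \in B ->
    ~ biconnected (@induced T e B).
  pose A := [set z | adjeq e x z && adjeq e y z].
  case: (H _ A (ltnSn _)); rewrite ?inE ?adj_adjeq //.
  apply: (@biconnected_two_hubs x y).
  - by rewrite inE /adjeq eqxx orbT esym xy.
  - by rewrite inE /adjeq eqxx orbT xy.
  - by apply: contraTneq xy => ->; rewrite eirr.
  - by move=> z; rewrite inE.
elim: n B => [//|n IH] B cB aB bB bic.
suff cl : clique e B.
  by move: nab; rewrite /adjeq negb_or => /andP[/negP nab nE]; apply/nab/cl.
apply: HB; split=> // B' sB bic'; apply/eqP; rewrite eq_sym eqEsubset sB /=.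
apply: contraT => nB; case: (IH B') => //; try by apply: (subsetP sB).
by rewrite ltnS in cB; apply: leq_trans cB; apply: proper_card; rewrite properC properE sB.
Qed.

(** Without induced paths on three vertices, a connecting path shrinks to a single edge by induction
    on its length. *)
Lemma cluster_deletion_setP S : cluster_deletion_set e S <-> P3_free e S.
Proof.
split=> [H a b c aS bS cS ab bc|H x y z].
  have [->|ac] := eqVneq a c; first by rewrite /adjeq eqxx orbT.
  have inC w : w \notin S -> w \in ~: S by rewrite inE.
  pose s w (wS : w \notin S) : {x | x \in ~: S} := exist _ w (inC w wS).
  apply: adj_adjeq; apply: (H (s a aS) (s a aS) (s c cS)); rewrite ?inE //.
  by apply: (@connect_trans _ _ (s b bS)); apply: connect1.
rewrite !inE => xy xz yz.
have sy : symmetric (@gdel T e S) by move=> u w; exact: esym.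
have : connect (@gdel T e S) y z by apply: connect_trans xz; rewrite (sym_connect_sym sy).
have notS (w : {x | x \in ~: S}) : val w \notin S by have := valP w; rewrite inE.
case/connectP=> p; elim/last_ind: p z yz {xz} => [|p w IH] z yz.
  by move=> _ E; rewrite E eqxx in yz.
rewrite rcons_path last_rcons => /andP[pp lw] zw; rewrite zw in yz *.
have [E|nE] := eqVneq y (last y p); first by rewrite {1}E.
have yl := IH _ nE pp erefl.
have /orP[//|/eqP/val_inj E] : adjeq e (val y) (val w).
  exact: (H _ (val (last y p))).
by rewrite E eqxx in yz.
Qed.

(** Deleted vertices remain as isolated vertices, so that all stages of the algorithm share the
    vertex type [T]. *)
Definition gminus (D : {set T}) : rel T :=
  fun x y => [&& e x y, x \notin D & y \notin D].

Lemma gminus_sym D : symmetric (gminus D).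
Proof. by move=> x y; rewrite /gminus esym [(x \notin D) && _]andbC. Qed.

Lemma gminus_irr D : irreflexive (gminus D).
Proof. by move=> x; rewrite /gminus eirr. Qed.

Lemma adjeq_gminus (D : {set T}) x y : x \notin D -> y \notin D ->
  adjeq (gminus D) x y = adjeq e x y.
Proof. by rewrite /adjeq /gminus => -> ->; rewrite !andbT. Qed.

Lemma induced_path_gminus (D : {set T}) p : all (fun x => x \notin D) p ->
  induced_path (gminus D) p = induced_path e p.
Proof.
elim: p => //= x [//|y p] IH /andP[xD pD]; rewrite IH //; congr (_ && _).
move: pD => /= /andP[yD /allP pD]; rewrite {1}/gminus xD yD !andbT; congr (_ && _).
by apply: eq_in_all => z /pD zD; rewrite adjeq_gminus.
Qed.

Lemma induced_path_alive (D : {set T}) x y p :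
  induced_path (gminus D) [:: x, y & p] -> all (fun x => x \notin D) [:: x, y & p].
Proof.
elim: p x y => [|z p IH] x y /andP[/andP[/and3P[_ xD yD] _] P].
  by rewrite /= xD yD.
by have := IH _ _ P; rewrite /= xD.
Qed.

Lemma gminus_extendable D : extendable e -> extendable (gminus D).
Proof.
move=> ext y x0 x1 p P /and3P[yx0 yD x0D] yx1.
have aP := induced_path_alive P; have /and3P[_ x1D _] := aP.
rewrite induced_path_gminus; last by rewrite /= yD; exact: aP.
rewrite induced_path_gminus // in P; apply: ext => //.
by rewrite -(adjeq_gminus yD x1D).
Qed.

Lemma gminus_diamond_free D : diamond_free e -> diamond_free (gminus D).
Proof.
move=> df x y a b /and3P[xy _ _] /and3P[xa _ aD] /and3P[ya _ _].
move=> /and3P[xb _ bD] /and3P[yb _ _]; rewrite adjeq_gminus //.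
exact: df xy xa ya xb yb.
Qed.

Lemma P3_free_gminus (D S : {set T}) : D \subset S ->
  P3_free (gminus D) S <-> P3_free e S.
Proof.
move=> sD; have nD x : x \notin S -> x \notin D by apply/contra/(subsetP sD).
split=> H a b c aS bS cS; have := H a b c aS bS cS;
  by rewrite /gminus adjeq_gminus ?nD // !andbT.
Qed.

(** * Greedy deletion *)

Definition greedy_step (D : {set T}) (v : T) : {set T} :=
  if rule (gminus D) v then v |: D else D.

Definition greedy_round (D : {set T}) : {set T} := foldl greedy_step D (enum T).

(** The greedy invariant. It is stated relative to every solution, so that no optimum has to be
    fixed. *)
Definition extends_to_optimum (D : {set T}) : Prop :=
  forall S, P3_free e S -> exists S' : {set T},
    [/\ D \subset S', P3_free e S' & #|S'| <= #|S|].

Lemma greedy_step_optimum D v :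
  extends_to_optimum D -> extends_to_optimum (greedy_step D v).
Proof.
rewrite /greedy_step; case: ifP => // rv H S /H[S' [DS PS cS]].
have [vS|vS] := boolP (v \in S').
  by exists S'; split=> //; rewrite subUset sub1set vS.
have PS' : P3_free (gminus D) S' by apply/P3_free_gminus.
(* The edge at [x] in [gminus D] shows that [x] is not in [D], so the exchanged solution still
   contains [D]. *)
have [x [y [xS /and3P[xy xD _] Px]]] := rule_sound (@gminus_sym D) (@gminus_irr D) rv PS' vS.
have DS' : D \subset v |: S' :\ x.
  apply/subsetP=> z zD; rewrite !inE (subsetP DS) // andbT.
  by apply/orP; right; apply: contraNneq xD => <-.
exists (v |: S' :\ x); split.
- by rewrite subUset sub1set DS' andbT !inE eqxx.
- exact/(P3_free_gminus DS').
- apply: leq_trans cS; rewrite cardsU1 (cardsD1 x S') xS.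
  by case: (v \notin _).
Qed.

Lemma greedy_round_optimum D :
  extends_to_optimum D -> extends_to_optimum (greedy_round D).
Proof.
by rewrite /greedy_round; elim: (enum T) D => //= v s IH D /(greedy_step_optimum v)/IH.
Qed.

Lemma greedy_step_sub (D : {set T}) v : D \subset greedy_step D v.
Proof. by rewrite /greedy_step; case: ifP => // _; apply: subsetUr. Qed.

Lemma foldl_greedy_sub s (D : {set T}) : D \subset foldl greedy_step D s.
Proof.
by elim: s D => //= v s IH D; apply: subset_trans (IH _); apply: greedy_step_sub.
Qed.

(** Steps only add vertices, so a round without effect consists of steps without effect. A selected
    vertex has an edge in [gminus D], hence lies outside [D] and would have been added. *)
Lemma greedy_round_fixed D v : greedy_round D = D -> ~~ rule (gminus D) v.
Proof.
have : v \in enum T by rewrite mem_enum.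
rewrite /greedy_round; elim: (enum T) => //= w s IH vs E.
have Ew : greedy_step D w = D.
  apply/eqP; rewrite eqEsubset greedy_step_sub andbT -{2}E.
  exact: foldl_greedy_sub.
rewrite Ew in E; move: vs; rewrite inE => /orP[/eqP->|/IH]; last exact.
apply: contraPN Ew; rewrite /greedy_step => rw; rewrite rw => /setP/(_ w).
have wD : w \notin D.
  case/orP: rw => [/existsP[c /andP[/andP[/and3P[]]]]//|].
  by case/existsP=> u /existsP[c /and4P[_ /and3P[]]].
by rewrite !inE eqxx (negbTE wD).
Qed.

(** Until a fixed point is reached, each round deletes at least one vertex, and [setT] is a fixed
    point. *)
Lemma greedy_converges k : #|T| <= k ->
  greedy_round (iter k greedy_round set0) = iter k greedy_round set0.
Proof.
move=> Tk; set D := iter k _ _.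
have sub (D' : {set T}) : D' \subset greedy_round D' by apply: foldl_greedy_sub.
suff [//|kD] : greedy_round D = D \/ k <= #|D|.
  have ED : D = setT.
    by apply/eqP; rewrite eqEcard subsetT cardsT (leq_trans Tk).
  by apply/eqP; rewrite eqEsubset sub andbT {2}ED subsetT.
rewrite {}/D; elim: k {Tk} => [|k [IH|IH]] /=; [by right | by left; rewrite !IH |].
set D := iter k _ _ in IH *; have [E|nE] := eqVneq (greedy_round D) D.
  by left; rewrite !E.
right; apply: leq_ltn_trans IH _; apply: proper_card.
by rewrite properEneq eq_sym nE sub.
Qed.

Lemma greedy_minimum k : block_graph e -> #|T| <= k ->
  min_cluster_deletion_set e (iter k greedy_round set0).
Proof.
move=> [ch bl] Tk; set D := iter k _ _.
have PD : P3_free e D.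
  apply/(P3_free_gminus (subxx D)) => a b c aD bD cD.
  apply: (@no_rule_P3_free _ _ (@gminus_sym D) (@gminus_irr D)); rewrite ?inE //.
  - exact/gminus_extendable/chordal_extendable.
  - exact/gminus_diamond_free/blocks_diamond_free.
  - by case=> v; apply/negP/greedy_round_fixed/greedy_converges.
have opt : extends_to_optimum D.
  rewrite /D; elim: (k) => [|i IH] /=; last exact: greedy_round_optimum.
  by move=> S PS; exists S; rewrite sub0set.
split; first exact/cluster_deletion_setP.
move=> S /cluster_deletion_setP/opt[S' [DS _ cS]].
by apply: leq_trans cS; apply: subset_leq_card.
Qed.

End BlockGraphs.

(** * A loop language for the random access machine *)

(* Register [rlim] holds the length of the input word, which bounds all loops,
   [rone] holds 1, and [rtmp] is overwritten by every loop test. *)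
Notation rtmp := 0 (only parsing).
Notation rone := 1 (only parsing).
Notation rlim := 2 (only parsing).

Inductive cmd :=
  | Op of instr
  | Seq of cmd & cmd
  | If of nat & cmd & cmd
  | For of nat & cmd.

Definition state := ((nat -> nat) * (nat -> nat))%type.

Definition setr (s : state) (r v : nat) : state := (upd s.1 r v, s.2).

Definition config_at (p : nat) (s : state) : config := Config p s.1 s.2.

(** The writes to [rtmp] by the compiled loop test are included, so that [den] yields the machine
    state exactly. *)
Fixpoint den (c : cmd) (s : state) : state :=
  match c with
  | Op i => let s' := exec i (config_at 0 s) in (regs s', cells s')
  | Seq c1 c2 => den c2 (den c1 s)
  | If r c1 c2 => if s.1 r == 0 then den c2 s else den c1 s
  | For x c =>
      let loop_body s :=
        let s' := den c (setr s rtmp (s.1 rlim - s.1 x)) in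
        setr s' x (s'.1 x + s'.1 rone) in
      let s' := iter (s.1 rlim) loop_body (setr s x 0) in
      setr s' rtmp (s'.1 rlim - s'.1 x)
  end.

Fixpoint csize (c : cmd) : nat :=
  match c with
  | Op _ => 1
  | Seq c1 c2 => csize c1 + csize c2
  | If _ c1 c2 => csize c1 + csize c2 + 2
  | For _ c => csize c + 5
  end.

(** Jump targets are absolute, hence the load address [p]. A loop is initialised at [p], re-entered
    at [p.+1] and left at [p + csize c + 5]. *)
Fixpoint compile (p : nat) (c : cmd) : program :=
  match c with
  | Op i => [:: i]
  | Seq c1 c2 => compile p c1 ++ compile (p + csize c1) c2
  | If r c1 c2 =>
      IJzero r (p + csize c1 + 2) :: compile p.+1 c1 ++
      IJump (p + csize c1 + csize c2 + 2) :: compile (p + csize c1 + 2) c2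
  | For x c =>
      [:: IConst x 0; ISub rtmp rlim x; IJzero rtmp (p + csize c + 5)] ++
      compile (p + 3) c ++ [:: IAdd x x rone; IJump p.+1]
  end.

Definition iwrites (i : instr) : seq nat :=
  match i with
  | IConst r _ | IAdd r _ _ | ISub r _ _ | IRead r _ => [:: r]
  | _ => [::]
  end.

Fixpoint writes (c : cmd) : seq nat :=
  match c with
  | Op i => iwrites i
  | Seq c1 c2 | If _ c1 c2 => writes c1 ++ writes c2
  | For x c => [:: rtmp, x & writes c]
  end.

Definition is_jump (i : instr) : bool :=
  match i with IJump _ | IJzero _ _ => true | _ => false end.

Fixpoint wf (c : cmd) : bool :=
  match c with
  | Op i => [&& ~~ is_jump i, rone \notin iwrites i & rlim \notin iwrites i]
  | Seq c1 c2 | If _ c1 c2 => wf c1 && wf c2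
  | For x c => [&& wf c, x \notin writes c & rlim < x]
  end.

(* An upper bound on the running time: both branches of a conditional count. *)
Fixpoint time (N : nat) (c : cmd) : nat :=
  match c with
  | Op _ => 1
  | Seq c1 c2 => time N c1 + time N c2
  | If _ c1 c2 => time N c1 + time N c2 + 2
  | For _ c => N * (time N c + 4) + 3
  end.

Lemma upd_neq f a v b : b != a -> upd f a v b = f b.
Proof. by rewrite /upd => /negbTE->. Qed.

Lemma upd_eq f a v : upd f a v a = v.
Proof. by rewrite /upd eqxx. Qed.

Lemma den_frame c s r : r \notin writes c -> (den c s).1 r = s.1 r.
Proof.
elim: c s => [i|c1 IH1 c2 IH2|q c1 IH1 c2 IH2|x c IH] s /=.
- by case: i => /= *; rewrite ?upd_neq // -mem_seq1.
- by rewrite mem_cat negb_or => /andP[h1 h2]; rewrite IH2 // IH1.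
- by rewrite mem_cat negb_or => /andP[h1 h2]; case: ifP => _; [exact: IH2|exact: IH1].
- rewrite !inE !negb_or => /and3P[h1 h2 h3]; rewrite upd_neq //.
  elim: (s.1 rlim) => [|m IHm] /=; first by rewrite upd_neq.
  by rewrite upd_neq // IH //= upd_neq.
Qed.

Lemma wf_writes c : wf c -> (rone \notin writes c) && (rlim \notin writes c).
Proof.
elim: c => [i|c1 IH1 c2 IH2|q c1 IH1 c2 IH2|x c IH] /=.
- by case/and3P=> _ -> ->.
- by case/andP=> /IH1/andP[a b] /IH2/andP[c d]; rewrite !mem_cat !negb_or a b c d.
- by case/andP=> /IH1/andP[a b] /IH2/andP[c d]; rewrite !mem_cat !negb_or a b c d.
- case/and3P=> /IH/andP[a b] _ hx; rewrite !inE !negb_or a b !andbT /=.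
  by apply/andP; split; rewrite neq_ltn ?hx // (ltn_trans _ hx).
Qed.

Definition ctx (N : nat) (s : state) := s.1 rone = 1 /\ s.1 rlim = N.

Lemma den_ctx N c s : wf c -> ctx N s -> ctx N (den c s).
Proof. by move=> /wf_writes/andP[h1 h2] [? ?]; split; rewrite den_frame. Qed.

Lemma ctx_setr N s r v : rlim < r -> ctx N s -> ctx N (setr s r v).
Proof. by move=> h [a b]; split; rewrite /= upd_neq // neq_ltn ?h // (ltn_trans _ h). Qed.

Lemma ctx_tmp N s v : ctx N s -> ctx N (setr s rtmp v).
Proof. by []. Qed.

Section LoopState.
Variables (N : nat) (x : nat) (c : cmd).
Hypothesis wfc : wf (For x c).

Definition loop_body (s : state) : state :=
  let s' := den c (setr s rtmp (s.1 rlim - s.1 x)) in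
  setr s' x (s'.1 x + s'.1 rone).

Lemma loop_bodyP s i : ctx N s -> s.1 x = i -> ctx N (loop_body s) /\ (loop_body s).1 x = i.+1.
Proof.
case/and3P: wfc => wc xc hx hs si.
have h : ctx N (den c (setr s rtmp (s.1 rlim - s.1 x))) by apply: den_ctx.
split; first exact: ctx_setr.
rewrite /loop_body /= upd_eq h.1 den_frame //= upd_neq ?si ?addn1 //.
by rewrite neq_ltn (ltn_trans _ hx) ?orbT.
Qed.

Lemma iter_loop_bodyP s i : ctx N s ->
  ctx N (iter i loop_body (setr s x 0)) /\ (iter i loop_body (setr s x 0)).1 x = i.
Proof.
move=> hs; elim: i => [|i [h1 h2]] /=; last exact: loop_bodyP.
by case/and3P: wfc => _ _ hx; split; [exact: ctx_setr | rewrite upd_eq].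
Qed.

(** The invariant rule for loops. The loop overhead changes [x] and [rtmp] between runs of the body,
    so [Inv] must be insensitive to these two registers. *)
Lemma ForP (Inv : nat -> state -> Prop) s :
  ctx N s ->
  (forall i s s', Inv i s -> s.2 = s'.2 ->
     (forall r, r != x -> r != rtmp -> s'.1 r = s.1 r) -> Inv i s') ->
  Inv 0 s ->
  (forall i s', i < N -> ctx N s' -> s'.1 x = i ->
     (forall r, r \notin writes (For x c) -> s'.1 r = s.1 r) ->
     Inv i s' -> Inv i.+1 (den c s')) ->
  Inv N (den (For x c) s).
Proof.
move=> hs st I0 IS; rewrite /= hs.2 -/loop_body.
have xN : x != rtmp by case/and3P: wfc => _ _ hx; rewrite neq_ltn (ltn_trans _ hx) ?orbT.
suff H i : i <= N ->
  Inv i (iter i loop_body (setr s x 0)) /\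
  (forall r, r \notin writes (For x c) -> (iter i loop_body (setr s x 0)).1 r = s.1 r).
  case: (H N (leqnn _)) => HN _.
  by apply: (st _ _ _ HN) => // r _ rt; rewrite /= upd_neq.
elim: i => [|i IH] iN /=.
  split; first by apply: (st _ _ _ I0) => // r rx _; rewrite /= upd_neq.
  by move=> r; rewrite !inE !negb_or => /and3P[_ rx _]; rewrite upd_neq.
have [hI hF] := IH (ltnW iN); have [hc hx] := iter_loop_bodyP i hs.
set s' := iter _ _ _ in hI hF hc hx *.
have hF' r : r \notin writes (For x c) ->
    (setr s' rtmp (s'.1 rlim - s'.1 x)).1 r = s.1 r.
  by move=> hr; rewrite /= upd_neq ?hF //; move: hr; rewrite !inE !negb_or => /and3P[].
split.
  rewrite /loop_body; apply: (st _ _ _ (IS i _ iN (ctx_tmp _ hc) _ hF' _)) => //=.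
  - by rewrite upd_neq.
  - by apply: (st _ _ _ hI) => // r _ rt; rewrite /= upd_neq.
  - by move=> r rx rt; rewrite /= upd_neq.
move=> r hr; rewrite /loop_body /=; move: (hr); rewrite !inE !negb_or => /and3P[rt rx rc].
by rewrite upd_neq // den_frame //= upd_neq // hF.
Qed.

End LoopState.

(** * Correctness and running time of compiled code *)

Definition code_at (P : program) (p : nat) (l : program) :=
  forall i, i < size l -> onth P (p + i) = onth l i.

Lemma code_at_cat P p l1 l2 : code_at P p (l1 ++ l2) ->
  code_at P p l1 /\ code_at P (p + size l1) l2.
Proof.
move=> h; split=> i hi.
  by rewrite h ?size_cat ?ltn_addr // onth_cat hi.
rewrite -addnA h ?size_cat ?ltn_add2l // onth_cat.
by rewrite ltnNge leq_addr /= addKn.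
Qed.

Lemma code_at_cons P p i l : code_at P p (i :: l) ->
  onth P p = Some i /\ code_at P p.+1 l.
Proof.
move=> h; split; first by have := h 0 isT; rewrite addn0.
by move=> j hj; rewrite addSnnS h.
Qed.

Lemma size_compile p c : size (compile p c) = csize c.
Proof.
by elim: c p => //= [c1 IH1 c2 IH2|r c1 IH1 c2 IH2|x c IH] p;
  rewrite !size_cat /= ?IH1 ?IH2 ?IH; lia.
Qed.

Definition reaches (P : program) (T : nat) (s s' : config) :=
  exists2 t, t <= T & iter t (step P) s = s'.

Lemma reaches_trans P T1 T2 s1 s2 s3 :
  reaches P T1 s1 s2 -> reaches P T2 s2 s3 -> reaches P (T1 + T2) s1 s3.
Proof.
case=> t1 h1 <- [t2 h2 <-]; exists (t2 + t1); last by rewrite iterD.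
by rewrite addnC leq_add.
Qed.

Lemma reaches_le P T1 T2 s1 s2 : T1 <= T2 -> reaches P T1 s1 s2 -> reaches P T2 s1 s2.
Proof. by move=> h [t ht e]; exists t => //; apply: leq_trans h. Qed.

Lemma reaches_step P s i : onth P (pc s) = Some i -> reaches P 1 s (exec i s).
Proof. by move=> h; exists 1 => //=; rewrite /step h. Qed.

Lemma compile_correct N P p c s :
  wf c -> ctx N s -> code_at P p (compile p c) ->
  reaches P (time N c) (config_at p s) (config_at (p + csize c) (den c s)).
Proof.
elim: c p s => [i|c1 IH1 c2 IH2|r c1 IH1 c2 IH2|x c IH] p s.
- move=> /and3P[nj _ _] _ /code_at_cons[h _].
  have -> : config_at (p + 1) (den (Op i) s) = exec i (config_at p s).
    by rewrite addn1; case: i nj {h}.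
  exact: reaches_step.
- case/andP=> w1 w2 hs /code_at_cat[h1 h2]; rewrite size_compile in h2.
  apply: reaches_trans (IH1 _ _ w1 hs h1) _; rewrite /= addnA.
  by apply: IH2 => //; apply: den_ctx.
- case/andP=> w1 w2 hs /code_at_cons[h0 /code_at_cat[h1 /code_at_cons[h2 h3]]].
  rewrite size_compile in h2 h3.
  have := @reaches_step P (config_at p s) _ h0; rewrite /=; case: eqP => _ h.
    apply: (@reaches_le _ (1 + time N c2)); first by lia.
    apply: reaches_trans h _.
    rewrite (_ : p + (_ + _) = p + csize c1 + 2 + csize c2); last by lia.
    apply: IH2 => //; move: h3; congr code_at; lia.
  apply: (@reaches_le _ (1 + (time N c1 + 1))); first by lia.
  apply: reaches_trans h _; apply: reaches_trans (IH1 _ _ w1 hs h1) _.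
  rewrite (_ : p + (_ + _) = p + csize c1 + csize c2 + 2); last by lia.
  exact: (@reaches_step P (config_at (p.+1 + csize c1) (den c1 s)) _ h2).
- move=> wx hs /code_at_cat[].
  move=> /code_at_cons[h0 /code_at_cons[h1 /code_at_cons[h2 _]]].
  move=> /code_at_cat[h3]; rewrite size_compile => /code_at_cons[h4 /code_at_cons[h5 _]].
  case/and3P: (wx) => wc xc hx.
  have xN : x != rtmp by rewrite neq_ltn (ltn_trans _ hx) ?orbT.
  have test s' : reaches P 2 (config_at p.+1 s')
      (config_at (if s'.1 rlim - s'.1 x == 0 then p + csize c + 5 else p + 3)
         (setr s' rtmp (s'.1 rlim - s'.1 x))).
    apply: (@reaches_trans _ 1 1).
      exact: (@reaches_step P (config_at p.+1 s') _ h1).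
    have := @reaches_step P (config_at p.+2 (setr s' rtmp (s'.1 rlim - s'.1 x))) _ h2.
    by rewrite /= upd_eq addn3.
  have loop i : i <= N -> reaches P (i * (time N c + 4) + 1) (config_at p s)
      (config_at p.+1 (iter i (loop_body x c) (setr s x 0))).
    elim: i => [|i IHi] iN; first exact: (@reaches_step P (config_at p s) _ h0).
    (* One iteration consists of two steps for the test, the body, the increment and the jump
       back. *)
    apply: (@reaches_le _ (i * (time N c + 4) + 1 + (2 + (time N c + (1 + 1))))).
      by rewrite mulSn; lia.
    apply: reaches_trans (IHi (ltnW iN)) _.
    have [hc hxi] := iter_loop_bodyP wx i hs; rewrite iterS.
    move: (iter i _ _) hc hxi => s' hc hxi.
    apply: reaches_trans (test s') _; rewrite hc.2 hxi subn_eq0 leqNgt iN /=.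
    apply: reaches_trans (IH (p + 3) _ wc (ctx_tmp _ hc) h3) _.
    apply: reaches_trans
      (@reaches_step P (config_at (p + 3 + csize c) _) _ h4) _.
    have := @reaches_step P (config_at (p + 3 + csize c).+1 (loop_body x c s')) _ h5.
    by rewrite /loop_body hc.2 hxi.
  apply: (@reaches_le _ (N * (time N c + 4) + 1 + 2)); first by rewrite /=; lia.
  apply: reaches_trans (loop N (leqnn _)) _.
  have [hc hxN] := iter_loop_bodyP wx N hs.
  have := test (iter N (loop_body x c) (setr s x 0)).
  by rewrite hxN hc.2 subnn /= hs.2 addnA hxN hc.2 subnn.
Qed.

(** The base [N.+1] keeps all powers positive, so that the coefficient absorbs additive constants. A
    loop raises the degree by one. *)
Lemma time_poly c : exists a k, forall N, time N c <= a * N.+1 ^ k.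
Proof.
elim: c => [i|c1 [a1 [k1 H1]] c2 [a2 [k2 H2]]|r c1 [a1 [k1 H1]] c2 [a2 [k2 H2]]|x c [a [k H]]].
- by exists 1, 0 => N.
- exists (a1 + a2), (maxn k1 k2) => N /=; rewrite mulnDl leq_add //.
    by apply: leq_trans (H1 N) _; rewrite leq_mul2l leq_pexp2l ?leq_maxl ?orbT.
  by apply: leq_trans (H2 N) _; rewrite leq_mul2l leq_pexp2l ?leq_maxr ?orbT.
- exists (a1 + a2 + 2), (maxn k1 k2) => N /=; rewrite !mulnDl !leq_add //.
  + by apply: leq_trans (H1 N) _; rewrite leq_mul2l leq_pexp2l ?leq_maxl ?orbT.
  + by apply: leq_trans (H2 N) _; rewrite leq_mul2l leq_pexp2l ?leq_maxr ?orbT.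
  + by rewrite leq_pmulr // expn_gt0.
- exists (a + 4 + 3), k.+1 => N /=; rewrite mulnDl leq_add //; last first.
    by rewrite leq_pmulr // expn_gt0.
  rewrite expnS mulnCA leq_mul // mulnDl leq_add //.
  by rewrite leq_pmulr // expn_gt0.
Qed.

(** * Evaluating first-order formulas *)

Notation rn := 3 (only parsing).
Notation rres := 4 (only parsing).
Notation racc := 5 (only parsing).
Notation rmul := 6 (only parsing).
Notation rt := 7 (only parsing).
Notation rround := 8 (only parsing).
Notation rvar i := (9 + i) (only parsing).

Notation "c1 ;; c2" := (Seq c1 c2) (at level 60, right associativity).

Definition skip : cmd := Op (IConst rt 0).

Definition when (r : nat) (c : cmd) : cmd := If r c skip.

Inductive formula :=
  | FConst of bool
  | FEq of nat & nat
  | FEdge of nat & nat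
  | FIf of formula & formula & formula
  | FAll of formula.

(* Variables are de Bruijn levels: a formula under d quantifiers refers to the
   variables 0, .., d - 1, the last one being the most recently bound. *)
Fixpoint fwf (d : nat) (f : formula) : bool :=
  match f with
  | FConst _ => true
  | FEq i j | FEdge i j => (i < d) && (j < d)
  | FIf f g h => [&& fwf d f, fwf d g & fwf d h]
  | FAll f => fwf d.+1 f
  end.

(** The deletion flag of a vertex [v] is in cell [rlim + 1 + v]; truncated subtraction clears the
    edge bit in [rres] if the flag is set. *)
Definition sub_deleted (i : nat) : cmd :=
  Op (IAdd racc rlim rone) ;; Op (IAdd racc racc (rvar i)) ;;
  Op (IRead racc racc) ;; Op (ISub rres rres racc).

(** The machine has no multiplication: the row offset arises by adding [n] once for each counter
    value below the row index. *)
Definition eval_edge (i j : nat) : cmd :=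
  Op (IAdd racc (rvar j) rone) ;;
  For rmul (Op (ISub rt (rvar i) rmul) ;; when rt (Op (IAdd racc racc rn))) ;;
  Op (IRead rres racc) ;; sub_deleted i ;; sub_deleted j.

(** Equality of [x] and [y] is [1 - ((x - y) + (y - x))] in truncated arithmetic. In a quantifier
    loop, [rt] filters out counter values from [n] on, and [rres] accumulates the conjunction. *)
Fixpoint eval (d : nat) (f : formula) : cmd :=
  match f with
  | FConst b => Op (IConst rres b)
  | FEq i j =>
      Op (ISub racc (rvar i) (rvar j)) ;; Op (ISub rres (rvar j) (rvar i)) ;;
      Op (IAdd rres rres racc) ;; Op (ISub rres rone rres)
  | FEdge i j => eval_edge i j
  | FIf f g h => eval d f ;; If rres (eval d g) (eval d h)
  | FAll f =>
      Op (IConst rres 1) ;;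
      For (rvar d) (Op (ISub rt rn (rvar d)) ;;
                    when rt (when rres (eval d.+1 f)))
  end.

Lemma writes_eval d f r : r \in writes (eval d f) ->
  (r \in [:: rtmp; rres; racc; rmul; rt]) || (rvar d <= r).
Proof.
elim: f d r => [b|i j|i j|f IHf g IHg h IHh|f IHf] d r /=.
- by rewrite !inE => ->; rewrite ?orbT.
- by rewrite !inE => /or4P[] ->; rewrite ?orbT.
- by rewrite !inE; do !case: eqP => //=.
- by rewrite !mem_cat => /or3P[/IHf|/IHg|/IHh].
- rewrite !inE !mem_cat !inE => H.
  have [/IHf|nf] := boolP (r \in writes (eval d.+1 f)); last first.
    by move: H; rewrite (negbTE nf) /=; do !case: eqP => //=; lia.
  by rewrite !inE; do !case: eqP => //=; lia.
Qed.

Lemma wf_eval d f : wf (eval d f).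
Proof.
elim: f d => //= [f IHf g IHg h IHh|f IHf] d; first by rewrite IHf IHg IHh.
rewrite IHf /= andbT !(inE, mem_cat); apply/negP.
by case/or3P=> [|/orP[/writes_eval|]|]; rewrite ?inE; lia.
Qed.

Lemma eval_keeps d f s r : r \in [:: rone; rlim; rn; rround] ++ iota 9 d ->
  (den (eval d f) s).1 r = s.1 r.
Proof.
move=> hr; apply: den_frame; apply/negP=> /writes_eval.
by move: hr; rewrite mem_cat mem_iota !inE; lia.
Qed.

Section Evaluation.
Variables (n : nat) (e : rel 'I_n) (D : {set 'I_n}).

Definition edge_nat (g : rel 'I_n) : rel nat := fun i j =>
  if insub i is Some a then if insub j is Some b then g a b else false else false.

Lemma edge_natE g (a b : 'I_n) : edge_nat g a b = g a b.
Proof. by rewrite /edge_nat !valK. Qed.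

Fixpoint sat (g : rel 'I_n) (env : seq nat) (f : formula) : bool :=
  match f with
  | FConst b => b
  | FEq i j => nth 0 env i == nth 0 env j
  | FEdge i j => edge_nat g (nth 0 env i) (nth 0 env j)
  | FIf f1 f2 f3 => if sat g env f1 then sat g env f2 else sat g env f3
  | FAll f => all (fun x => sat g (rcons env x) f) (iota 0 n)
  end.

(* The deletion flags live right behind the input word, where the memory is
   initially zero. *)
Definition stores (M : nat -> nat) : Prop :=
  (forall i j : 'I_n, M (i * n + j).+1 = e i j) /\
  (forall i : 'I_n, M (n * n + i).+1 = (i \in D)).

Definition rep (s : state) : Prop := [/\ ctx (n * n) s, s.1 rn = n & stores s.2].

(** Loops run [n * n] times; this bound shows that they reach every vertex. *)
Lemma leq_mulnn m : m <= m * m.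
Proof. by case: m => // m; rewrite leq_pmulr. Qed.

Lemma rep_eq s s' : rep s -> s'.2 = s.2 ->
  (forall r, r \in [:: rone; rlim; rn] -> s'.1 r = s.1 r) -> rep s'.
Proof.
by case=> -[h1 h2] h3 h4 E F; split; [split| |]; rewrite ?E ?F.
Qed.

Lemma eval_edgeP i j (a b : 'I_n) s : rep s ->
  s.1 (rvar i) = a -> s.1 (rvar j) = b ->
  (den (eval_edge i j) s).2 = s.2 /\
  (den (eval_edge i j) s).1 rres = gminus e D a b.
Proof.
move=> [hc hn [hE hD]] sa sb.
set c := For rmul (Op (ISub rt (rvar i) rmul) ;; when rt (Op (IAdd racc racc rn))).
set s1 := den (Op (IAdd racc (rvar j) rone)) s.
have hc1 : ctx (n * n) s1 by [].
have s1r r : r != racc -> s1.1 r = s.1 r by move=> hr; rewrite /= upd_neq.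
have [m2 acc2] : (den c s1).2 = s.2 /\
    (den c s1).1 racc = b.+1 + minn (n * n) a * n.
  pose Inv k (s' : state) := s'.2 = s.2 /\ s'.1 racc = b.+1 + minn k a * n.
  apply: (@ForP (n * n) _ _ _ Inv) => //.
  - by move=> k s2 s3 [h1 h2] h3 h4; split; rewrite -?h3 ?h4.
  - by split=> //; rewrite /= upd_eq sb hc.1 min0n addn1 addn0.
  - move=> k s' kN hc' sk fr [h1 h2].
    have si : s'.1 (rvar i) = a by rewrite fr // s1r.
    have sn : s'.1 rn = n by rewrite fr // s1r.
    rewrite /Inv /= upd_eq si sk; case: eqP => hk /=.
      by rewrite h1 !upd_neq // h2; split=> //; congr (_ + _ * _); lia.
    rewrite h1 !upd_eq !upd_neq // h2 sn; split=> //.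
    by rewrite (_ : minn k.+1 a = (minn k a).+1) ?mulSn; lia.
have an : minn (n * n) a = a.
  by apply/minn_idPr/ltnW/(leq_trans (ltn_ord a))/leq_mulnn.
have keep r : r \notin [:: rtmp; racc; rmul; rt] -> (den c s1).1 r = s.1 r.
  rewrite !inE !negb_or => /and4P[? ? ? ?].
  by rewrite den_frame ?s1r // !inE !negb_or; apply/and5P; split.
have -> : den (eval_edge i j) s =
    den (Op (IRead rres racc) ;; sub_deleted i ;; sub_deleted j) (den c s1) by [].
move: (den c s1) m2 acc2 keep => s2 m2 acc2 keep.
rewrite /= /upd /= m2 acc2 an !keep // sa sb hc.1 hc.2.
rewrite [b.+1 + _]addnC addnS hE addn1 !addSn !hD /gminus; split=> //.
by case: (e a b); case: (a \in D); case: (b \in D).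
Qed.

Lemma evalP f env s : fwf (size env) f -> rep s ->
  all (fun x => x < n) env ->
  (forall i, i < size env -> s.1 (rvar i) = nth 0 env i) ->
  (den (eval (size env) f) s).2 = s.2 /\
  (den (eval (size env) f) s).1 rres = sat (gminus e D) env f.
Proof.
elim: f env s => [b|i j|i j|f IHf g IHg h IHh|f IHf] env s.
- by [].
- case/andP=> hi hj [[h1 _] _ _] _ hs.
  rewrite /= /upd /= !hs // h1; split=> //.
  by case: eqP; lia.
- case/andP=> hi hj hr /allP henv hs.
  have [hi' hj'] := (henv _ (mem_nth 0 hi), henv _ (mem_nth 0 hj)).
  have := @eval_edgeP i j (Ordinal hi') (Ordinal hj') s hr (hs _ hi) (hs _ hj).
  by rewrite -edge_natE.
- case/and3P=> wf_f wf_g wf_h hr henv hs.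
  have [m1 r1] := IHf env s wf_f hr henv hs.
  have keep1 r hr' := @eval_keeps (size env) f s r hr'.
  have hr1 : rep (den (eval (size env) f) s).
    by apply: rep_eq hr _ _ => // r hr; rewrite keep1 // mem_cat; move: hr; rewrite !inE => /or3P[] ->; rewrite ?orbT.
  have hs1 i : i < size env -> (den (eval (size env) f) s).1 (rvar i) = nth 0 env i.
    by move=> hi; rewrite keep1 ?hs // mem_cat mem_iota; lia.
  rewrite /= r1; case: (sat _ env f) => /=; rewrite -m1.
    exact: IHg.
  exact: IHh.
- move=> wf_f hr henv hs; set d := size env; set E := gminus e D.
  pose P x := sat E (rcons env x) f.
  (* Runs with a counter of at least [n] are idle, hence [minn k n]. *)
  pose Inv k (s' : state) := [/\ s'.2 = s.2,
    s'.1 rres = all P (iota 0 (minn k n)) :> nat &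
    forall i, i < d -> s'.1 (rvar i) = nth 0 env i].
  have wfF := wf_eval d (FAll f).
  set s0 := den (Op (IConst rres 1)) s.
  have hc0 : ctx (n * n) s0 by case: hr.
  suff [h1 h2 _] : Inv (n * n) (den (For (rvar d) (Op (ISub rt rn (rvar d)) ;;
                    when rt (when rres (eval d.+1 f)))) s0).
    by split=> //; rewrite [LHS]h2 (minn_idPr (leq_mulnn n)).
  apply: (@ForP (n * n)) => //.
  + move=> k s2 s3 [h1 h2 h3] h4 h5; split; rewrite -?h4 ?h5 //.
    by move=> i hi; rewrite h5 ?h3 //; lia.
  + by split=> //; rewrite min0n.
  move=> k s' kN hc' sk fr [h1 h2 h3].
  have keep r : r \in [:: rone; rlim; rn] -> s'.1 r = s.1 r.
    move=> hr'; rewrite fr; first by move: hr'; rewrite !inE => /or3P[] /eqP->.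
    apply/negP=> h; have := @writes_eval d (FAll f) r.
    rewrite [eval d _]/= [writes _]/= inE.
    by move: h hr'; rewrite [writes _]/= => ->; rewrite orbT !inE => + /(_ isT); lia.
  have hn : s'.1 rn = n by rewrite keep //; case: hr.
  rewrite /= upd_eq hn sk subn_eq0; case: (leqP n k) => kn /=.
    rewrite /Inv /= !upd_neq // h1 h2 (minn_idPr kn) (minn_idPr (leqW kn)).
    by split=> // i hi; rewrite !upd_neq ?h3 //.
  rewrite [upd s'.1 rt _ rres]upd_neq // h2 (minn_idPl (ltnW kn)).
  rewrite /Inv (minn_idPl kn) -(addn1 k) iotaD all_cat /= andbT.
  rewrite (minn_idPl (ltnW kn)) in h2; case: (all P _) h2 => h2 /=; last first.
    split; [exact: h1 | by rewrite !upd_neq | move=> i hi].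
    by rewrite !upd_neq ?h3.
  set s2 := (upd _ _ _, _).
  have s2r r : r != rt -> s2.1 r = s'.1 r by move=> hr'; rewrite /= upd_neq.
  have [||||m2 r2] := IHf (rcons env k) s2; rewrite ?size_rcons //.
  - apply: rep_eq hr _ _ => // r hr'; rewrite s2r ?keep //.
    by move: hr'; rewrite !inE => /or3P[] /eqP->.
  - by rewrite all_rcons kn.
  - move=> i; rewrite ltnS leq_eqVlt nth_rcons => /orP[/eqP->|hi].
      by rewrite ltnn eqxx s2r.
    by rewrite hi s2r // h3.
  rewrite size_rcons in m2 r2; split=> //; first by rewrite m2.
  move=> i hi; rewrite eval_keeps ?s2r ?h3 //.
  by rewrite mem_cat mem_iota; lia.
Qed.

End Evaluation.

(** * The program *)

Definition fneg f := FIf f (FConst false) (FConst true).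
Definition fconj f g := FIf f g (FConst false).
Definition fdisj f g := FIf f (FConst true) g.
Definition fimpl f g := FIf f g (FConst true).
Definition fequiv f g := FIf f g (fneg g).
Definition fexists f := fneg (FAll (fneg f)).
Definition fadjeq i j := fdisj (FEdge i j) (FEq i j).

(** The argument [d] is the number of variables in scope, so the two inner quantifiers bind the
    levels [d] and [d.+1]. *)
Definition fpendant d c u :=
  fconj (FEdge c u) (FAll (fimpl (FEdge d c) (fimpl (fneg (FEq d u))
    (FAll (fequiv (fadjeq d d.+1) (fadjeq c d.+1)))))).

(** The levels 0 to 4 stand for [v], [c], [w], [d] and [y] of [rule_twin]. *)
Definition ftwin :=
  fexists (fconj (fpendant 2 1 0) (fexists (fconj (FEdge 2 0) (fconj (fneg (fadjeq 1 2))
    (fexists (fconj (fdisj (FEq 3 0) (fpendant 4 3 2))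
      (FAll (fimpl (FEdge 2 4) (fdisj (fadjeq 3 4) (fadjeq 0 4)))))))))).

(** The levels 0 to 3 stand for [v], [u], [c] and [y] of [rule_exit]. *)
Definition fexit :=
  fexists (fexists (fconj (fpendant 3 2 1) (fconj (FEdge 1 0) (fconj (fneg (fadjeq 2 0))
    (FAll (fimpl (FEdge 1 3) (fdisj (fadjeq 2 3) (FEq 3 0)))))))).

Definition frule := fdisj ftwin fexit.

(** * Agreement of the formulas with the deletion rules *)

Section Formulas.
Variables (n : nat) (g : rel 'I_n).
Implicit Types (f h : formula) (env : seq nat).

Lemma sat_not env f : sat g env (fneg f) = ~~ sat g env f.
Proof. by rewrite /=; case: sat. Qed.

Lemma sat_and env f h : sat g env (fconj f h) = sat g env f && sat g env h.
Proof. by []. Qed.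

Lemma sat_or env f h : sat g env (fdisj f h) = sat g env f || sat g env h.
Proof. by []. Qed.

Lemma sat_imp env f h : sat g env (fimpl f h) = (sat g env f ==> sat g env h).
Proof. by []. Qed.

Lemma sat_iff env f h : sat g env (fequiv f h) = (sat g env f == sat g env h).
Proof. by rewrite /=; case: (sat g env f); case: (sat g env h). Qed.

Lemma sat_all env f : sat g env (FAll f) = [forall x : 'I_n, sat g (rcons env x) f].
Proof.
apply/allP/forallP => /= [H x|H i]; first by apply: H; rewrite mem_iota /= ltn_ord.
by rewrite mem_iota => hi; apply: (H (Ordinal hi)).
Qed.

Lemma sat_ex env f : sat g env (fexists f) = [exists x : 'I_n, sat g (rcons env x) f].
Proof.
rewrite sat_not sat_all negb_forall; apply: eq_existsb => x.
by rewrite sat_not negbK.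
Qed.

Lemma sat_edge env i j (x y : 'I_n) : nth 0 env i = x -> nth 0 env j = y ->
  sat g env (FEdge i j) = g x y.
Proof. by rewrite /= => -> ->; rewrite edge_natE. Qed.

Lemma sat_eq env i j (x y : 'I_n) : nth 0 env i = x -> nth 0 env j = y ->
  sat g env (FEq i j) = (x == y).
Proof. by rewrite /= => -> ->. Qed.

Lemma sat_adjeq env i j (x y : 'I_n) : nth 0 env i = x -> nth 0 env j = y ->
  sat g env (fadjeq i j) = adjeq g x y.
Proof.
by move=> hx hy; rewrite sat_or (sat_edge hx hy) (sat_eq hx hy).
Qed.

Lemma sat_pendant d env c u (x y : 'I_n) : d = size env -> c < d -> u < d ->
  nth 0 env c = x -> nth 0 env u = y ->
  sat g env (fpendant d c u) = pendant g x y.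
Proof.
move=> -> hc hu cx uy; rewrite sat_and (sat_edge cx uy) sat_all; congr (_ && _).
apply: eq_forallb => a; have ea : nth 0 (rcons env a) (size env) = a.
  by rewrite nth_rcons ltnn eqxx.
have ec : nth 0 (rcons env a) c = x by rewrite nth_rcons hc.
have eu : nth 0 (rcons env a) u = y by rewrite nth_rcons hu.
rewrite sat_imp sat_imp sat_not (sat_edge ea ec) (sat_eq ea eu) sat_all.
congr (_ ==> (_ ==> _)); apply: eq_forallb => b.
rewrite sat_iff (@sat_adjeq _ _ _ a b) 1?(@sat_adjeq _ _ _ x b) //;
  by rewrite nth_rcons size_rcons ?ltnn ?eqxx ?ltnSn ?(leqW hc).
Qed.

Lemma sat_rule (v : 'I_n) : sat g [:: val v] frule = rule g v.
Proof.
rewrite sat_or /rule; congr (_ || _); rewrite sat_ex; apply: eq_existsb => c.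
  rewrite sat_and (@sat_pendant _ _ _ _ c v) // sat_ex; congr (_ && _).
  apply: eq_existsb => w; rewrite !sat_and sat_not sat_ex.
  rewrite (@sat_edge _ _ _ w v) // (@sat_adjeq _ _ _ c w) //; congr [&& _, _ & _].
  apply: eq_existsb => d.
  rewrite sat_and sat_or (@sat_eq _ _ _ d v) // (@sat_pendant _ _ _ _ d w) //.
  rewrite sat_all; congr (_ && _); apply: eq_forallb => y.
  rewrite sat_imp sat_or (@sat_edge _ _ _ w y) //.
  by rewrite (@sat_adjeq _ _ _ d y) // (@sat_adjeq _ _ _ v y).
(* Here [c] and [d] play the roles of [u] and [c] in [rule_exit]. *)
rewrite sat_ex; apply: eq_existsb => d.
rewrite sat_and (@sat_pendant _ _ _ _ d c) // !sat_and sat_not (@sat_edge _ _ _ c v) //.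
rewrite (@sat_adjeq _ _ _ d v) // sat_all; congr [&& _, _, _ & _].
apply: eq_forallb => y; rewrite sat_imp sat_or (@sat_edge _ _ _ c y) //.
by rewrite (@sat_adjeq _ _ _ d y) // (@sat_eq _ _ _ y v).
Qed.

End Formulas.

(* [racc] runs through the squares until it reaches the input length. *)
Definition compute_order : cmd :=
  For rround (Op (ISub rt rlim racc) ;;
    when rt (Op (IAdd racc racc rn) ;; Op (IAdd racc racc rn) ;;
             Op (IAdd racc racc rone) ;; Op (IAdd rn rn rone))).

Definition delete_vertex : cmd :=
  Op (IAdd racc rlim rone) ;; Op (IAdd racc racc (rvar 0)) ;;
  Op (IWrite racc rone).

Definition round_step : cmd :=
  Op (ISub rt rn (rvar 0)) ;; when rt (eval 1 frule ;; when rres delete_vertex).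

(** This exposes the branches of the step while keeping the large command [eval 1 frule] folded. *)
Lemma den_round_step s (s1 := den (Op (ISub rt rn (rvar 0))) s) :
  den round_step s = if s1.1 rt == 0 then den skip s1
                     else den (when rres delete_vertex) (den (eval 1 frule) s1).
Proof. by []. Qed.

Definition output_step : cmd :=
  Op (ISub rt rn (rvar 0)) ;;
  when rt (Op (IAdd racc rlim rone) ;; Op (IAdd racc racc (rvar 0)) ;;
           Op (IRead rres racc) ;; Op (IAdd racc (rvar 0) rone) ;;
           Op (IWrite racc rres)).

Definition greedy_cmd : cmd :=
  compute_order ;;
  For rround (For (rvar 0) round_step) ;;
  For (rvar 0) output_step ;; Op (IConst racc 0) ;; Op (IWrite racc rn).

(** Initially [racc] is 0, so the second instruction loads the input length from cell 0. The
    compiled code follows at address 2. *)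
Definition greedy_program : program :=
  [:: IConst rone 1; IRead rlim racc] ++ compile 2 greedy_cmd.

Lemma code_at_suffix l1 l2 : code_at (l1 ++ l2) (size l1) l2.
Proof. by move=> i _; rewrite onth_cat ltnNge leq_addr /= addKn. Qed.

Lemma wf_greedy_cmd : wf greedy_cmd.
Proof. by vm_compute. Qed.

(** Each active run uses [(m + 1)^2 = m^2 + m + m + 1], and the square reaches [n * n] exactly when
    [m = n]. *)
Lemma compute_orderP n s : ctx (n * n) s -> s.1 rn = 0 -> s.1 racc = 0 ->
  (den compute_order s).2 = s.2 /\ (den compute_order s).1 rn = n.
Proof.
move=> hc h1 h2.
pose Inv k (s' : state) := [/\ s'.2 = s.2, s'.1 rn = minn k n &
  s'.1 racc = minn k n * minn k n].
suff [-> -> _] : Inv (n * n) (den compute_order s).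
  by split=> //; apply/minn_idPr/leq_mulnn.
apply: (@ForP (n * n)) => //.
- by move=> k s2 s3 [a b c] d f; split; rewrite -?d ?f.
- by split=> //; rewrite min0n.
move=> k s' kN hc' sk _ [m' n' a'].
have E : (n * n - minn k n * minn k n == 0) = (n <= k).
  rewrite subn_eq0; case: (leqP n k) => h; first by rewrite leqnn.
  by rewrite !mulnn leq_sqr leqNgt h.
rewrite /Inv /= upd_eq hc'.2 a' E; case: (leqP n k) => kn /=.
  by rewrite /upd /= m' n' a' (minn_idPr kn) (minn_idPr (leqW kn)).
rewrite /upd /= m' n' a' hc'.1 (minn_idPl (ltnW kn)) (minn_idPl kn).
by split=> //; lia.
Qed.

(** * Simulation of the greedy algorithm *)

Section Main.
Variables (n : nat) (e : rel 'I_n).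

Lemma round_stepP (D : {set 'I_n}) (v : 'I_n) s : rep e D s -> s.1 (rvar 0) = v ->
  rep e (greedy_step e D v) (den round_step s).
Proof.
move=> hr sv; have [hc hn hM] := hr.
set s1 := den (Op (ISub rt rn (rvar 0))) s.
have r1 : rep e D s1 by [].
have env1 : all (fun x => x < n) [:: val v] by rewrite /= ltn_ord.
have vars i : i < 1 -> s1.1 (rvar i) = nth 0 [:: val v] i by case: i.
have [m2 v2] : (den (eval 1 frule) s1).2 = s1.2 /\
    (den (eval 1 frule) s1).1 rres = rule (gminus e D) v.
  by rewrite -sat_rule; exact: (@evalP n e D frule [:: val v] s1 isT r1 env1 vars).
have t1 : (s1.1 rt == 0) = false by rewrite /= upd_eq hn sv subn_eq0 leqNgt ltn_ord.
rewrite den_round_step -/s1 t1.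
have keep r := @eval_keeps 1 frule s1 r.
move: (den (eval 1 frule) s1) m2 v2 keep => s2 m2 v2 keep.
have r2 : rep e D s2.
  by apply: rep_eq r1 m2 _ => r hr'; apply: keep; move: hr'; rewrite !inE => /or3P[] ->; rewrite ?orbT.
rewrite /greedy_step /= v2; case: (rule _ v) => /=; last first.
  by apply: rep_eq r2 _ _ => // r; rewrite !inE => /or3P[] /eqP->.
have [[h1 h2] h3 [hE hD]] := r2.
have s2v : s2.1 9 = v by rewrite keep.
split; [by [] | by [] |]; rewrite /upd /= h1 h2 s2v addn1 addSn; split=> [i j|i] /=.
  (* Matrix entries have index [i * n + j < n * n], so writing a flag leaves them intact. *)
  rewrite eqSS (_ : _ == _ = false) ?hE //; apply/negbTE; rewrite neq_ltn.
  have := leq_mul (ltn_ord i) (leqnn n); have := ltn_ord j.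
  by rewrite mulSn; lia.
rewrite eqSS eqn_add2l !inE hD -val_eqE.
by case: (_ == _).
Qed.

Lemma roundP (D : {set 'I_n}) s : rep e D s ->
  rep e (greedy_round e D) (den (For (rvar 0) round_step) s).
Proof.
move=> hr; pose Inv k s' := rep e (foldl (greedy_step e) D (take k (enum 'I_n))) s'.
suff : Inv (n * n) (den (For (rvar 0) round_step) s).
  by rewrite /Inv take_oversize // size_enum_ord leq_mulnn.
apply: (@ForP (n * n)).
- by vm_compute.
- by case: hr.
- move=> k s1 s2 h1 h2 h3; apply: rep_eq h1 _ _ => // r.
  by rewrite !inE => /or3P[] /eqP->; rewrite h3.
- by rewrite /Inv take0.
move=> k s' kN hc' sk fr h.
have [kn|kn] := ltnP k n; last first.
  rewrite /Inv in h *; rewrite !take_oversize ?size_enum_ord ?(leqW kn) // in h *.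
  have [_ hn _] := h.
  rewrite den_round_step [_.1 rt]upd_eq hn sk subn_eq0 kn.
  by apply: rep_eq h _ _ => // r; rewrite !inE => /or3P[] /eqP->.
rewrite /Inv (take_nth (Ordinal kn)) ?size_enum_ord // foldl_rcons.
rewrite (_ : nth _ _ k = Ordinal kn); last exact: (nth_ord_enum _ (Ordinal kn)).
exact: round_stepP.
Qed.

Lemma roundsP s : rep e set0 s ->
  rep e (iter (n * n) (greedy_round e) set0)
    (den (For rround (For (rvar 0) round_step)) s).
Proof.
move=> hr; apply: (@ForP (n * n) _ _ _ (fun k => rep e (iter k (greedy_round e) set0))).
- by vm_compute.
- by case: hr.
- move=> k s1 s2 h1 h2 h3; apply: rep_eq h1 _ _ => // r.
  by rewrite !inE => /or3P[] /eqP->; rewrite h3.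
- by [].
- by move=> k s' _ _ _ _ /roundP.
Qed.

Lemma outputP (D : {set 'I_n}) s : rep e D s ->
  let s' := den (For (rvar 0) output_step ;; Op (IConst racc 0) ;; Op (IWrite racc rn)) s in
  s'.2 0 = n /\ forall i : 'I_n, s'.2 i.+1 = (i \in D).
Proof.
move=> [hc hn [_ hD]].
pose Inv k (s' : state) := (forall i : 'I_n, i < k -> s'.2 i.+1 = (i \in D)) /\
  (forall i : 'I_n, s'.2 (n * n + i).+1 = (i \in D)).
have wfo : wf (For (rvar 0) output_step) by vm_compute.
have [h _] : Inv (n * n) (den (For (rvar 0) output_step) s).
  apply: (@ForP (n * n)) => //.
    by move=> k s1 s2 [h1 h2] h3 h4; split=> *; rewrite -h3 ?h1 ?h2.
  move=> k s' kN [h1 h2] sk fr [ih1 ih2].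
  have hn' : s'.1 rn = n by rewrite fr.
  rewrite /Inv [den _ _]/= upd_eq hn' sk subn_eq0; case: (leqP n k) => kn /=.
    by split=> // i _; apply: ih1; apply: leq_trans kn.
  rewrite /upd /= h1 h2 sk addn1 addn1 addSn (ih2 (Ordinal kn)); split=> i.
    rewrite ltnS leq_eqVlt eqSS => /orP[/eqP ik|ik].
      by rewrite ik eqxx (_ : i = Ordinal kn) //; apply: val_inj.
    by rewrite ltn_eqF // ih1.
  (* The output bit goes to cell [k.+1] with [k < n <= n * n], which lies below all flags. *)
  rewrite eqSS gtn_eqF ?ih2 //; apply: leq_trans kn _.
  exact: leq_trans (leq_mulnn n) (leq_addr _ _).
have hn' : (den (For (rvar 0) output_step) s).1 rn = n by rewrite den_frame.
rewrite -[den (_ ;; _) s]/(den (Op (IConst racc 0) ;; Op (IWrite racc rn))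
  (den (For (rvar 0) output_step) s)).
move: (den (For _ _) s) h hn' => s' h hn'; rewrite /= /upd /= hn'; split=> // i.
by apply: h; apply: leq_trans (ltn_ord i) (leq_mulnn n).
Qed.

End Main.

(** * Input encoding and the polynomial bound *)

Lemma nth_allpairs (S T R : Type) (f : S -> T -> R) x0 y0 r0 s t i j :
  i < size s -> j < size t ->
  nth r0 [seq f x y | x <- s, y <- t] (i * size t + j) = f (nth x0 s i) (nth y0 t j).
Proof.
elim: s i => //= x s IH [|i] hi hj; rewrite nth_cat size_map.
  by rewrite mul0n add0n hj (nth_map y0).
rewrite mulSn -addnA ltnNge leq_addr /= addKn; exact: IH.
Qed.

Lemma size_graph_word G : size (graph_word G) = gorder G * gorder G.
Proof. by rewrite size_allpairs size_enum_ord. Qed.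

Lemma nth_graph_word G (i j : 'I_(gorder G)) :
  nth false (graph_word G) (i * gorder G + j) = gedge i j.
Proof.
have := @nth_allpairs _ _ _ (@gedge G) i j false (enum 'I_(gorder G)) (enum 'I_(gorder G)) i j.
by rewrite size_enum_ord !nth_ord_enum => ->.
Qed.

(** For positive [N] the bound rests on [N.+1 <= 2 * N]; the additive term covers [N = 0]. The
    summand 2 is the cost of the two setup instructions. *)
Lemma leq_poly a k N : 2 + a * N.+1 ^ k <= (2 + a * 2 ^ k) * N ^ k + (2 + a * 2 ^ k).
Proof.
have h : N.+1 ^ k <= 2 ^ k * N ^ k + 2 ^ k.
  case: N => [|N]; first by rewrite exp1n (leq_trans _ (leq_addl _ _)) // expn_gt0.
  apply: leq_trans (leq_addr _ _); rewrite -expnMn.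
  by case: k => // k; rewrite leq_exp2r //; lia.
apply: (@leq_trans (a * (2 ^ k * N ^ k) + (2 + a * 2 ^ k))).
  by rewrite addnCA leq_add2l -mulnDr leq_mul2l h orbT.
by rewrite leq_add2r mulnDl -mulnA leq_addl.
Qed.

Theorem theorem5 :
  poly_time_solvable
    (fun G : sgraph => block_graph (@gedge G))
    graph_word
    (fun (G : sgraph) (out : seq bool) =>
       exists2 S : {set 'I_(gorder G)},
         min_cluster_deletion_set (@gedge G) S & out = set_word S).
Proof.
have [a [k hT]] := time_poly greedy_cmd.
exists greedy_program, (2 + a * 2 ^ k), k => G bG.
set n := gorder G; set w := graph_word G; set N := size w.
have EN : N = n * n by apply: size_graph_word.
(* This is the state after the two setup instructions. *)
pose s0 : state := (upd (upd (fun=> 0) rone 1) rlim N, word_mem w).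
have c0 : ctx (n * n) s0 by rewrite -EN.
have start2 : iter 2 (step greedy_program) (start w) = config_at 2 s0 by [].
have code : code_at greedy_program 2 (compile 2 greedy_cmd).
  exact: (@code_at_suffix [:: _; _]).
have [t ht run] := compile_correct wf_greedy_cmd c0 code.
set D := iter (n * n) (greedy_round (@gedge G)) set0.
have [c1 n1] := compute_orderP c0 erefl erefl.
have wf1 : wf compute_order by vm_compute.
have r1 : rep (@gedge G) set0 (den compute_order s0).
  split; [exact: den_ctx | by [] |]; rewrite c1; split=> [i j|i] /=.
    by rewrite nth_graph_word.
  (* Cells behind the input word are 0, so the stored flags represent [set0]. *)
  by rewrite nth_default ?inE // -/w -/N EN leq_addr.
have [out0 outD] : (den greedy_cmd s0).2 0 = n /\
    forall i : 'I_n, (den greedy_cmd s0).2 i.+1 = (i \in D).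
  exact: outputP (roundsP r1).
move: (den greedy_cmd s0) run out0 outD => s' run out0 outD.
exists (t + 2), (set_word D); split.
- apply: leq_trans (leq_poly a k N); rewrite addnC leq_add2l.
  by apply: leq_trans ht _; rewrite -EN; apply: hT.
- rewrite /computes_in iterD start2 run; split.
    by rewrite /halted /greedy_program size_cat size_compile.
  move=> [|i]; rewrite size_map size_enum_ord => hi /=.
    by rewrite size_map size_enum_ord.
  by rewrite (nth_map (Ordinal hi)) ?size_enum_ord // (nth_ord_enum _ (Ordinal hi)) (outD (Ordinal hi)).
- exists D => //; apply: greedy_minimum.
  + exact: gedge_sym.
  + exact: gedge_irr.
  + exact: bG.
  + by rewrite card_ord leq_mulnn.
Qed.
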